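(* There is a choice of durations $t_1,\tau_2,t_3>0$ (depending only on the box $\Theta$, not on $\theta$) such that $F_0$ maps $\Theta$ into $(0,1)^4$ and $F_0:\Theta\to F_0(\Theta)\subset(0,1)^4$ is a diffeomorphism (onto its image).
   Context: **Parameters.** $\theta=(\gamma_1,\kappa,\gamma_2,\omega)$ lies in a known open box $\Theta=(\underline\gamma_1,\overline\gamma_1)\times(\underline\kappa,\overline\kappa)\times(\underline\gamma_2,\overline\gamma_2)\times(\underline\omega,\overline\omega)$ whose closure is a compact subset of $(0,\infty)^4$. **Free evolution.** The Bloch vector $v=(x,y,z)\in\mathbb{R}^3$ of the uncontrolled open qubit evolves by $\dot v=A_0v+b$ with $$A_0=\begin{pmatrix}-\frac{\gamma_1}{2}-2\gamma_2&-\omega&0\\ \omega&-\frac{\gamma_1}{2}-2\gamma_2&0\\0&0&-\gamma_1\end{pmatrix},\quad b=\begin{pmatrix}0\\0\\\gamma_1\end{pmatrix}.$$ Let $R_t(v)=e^{A_0t}v+\int_0^te^{A_0(t-s)}b\,ds$. **Ideal pulses.** For $\tau_2>0$ let $P_0^{\pm}(v)=e^{\pm\kappa\tau_2\Omega_x}v$ with $\Omega_x=\begin{pmatrix}0&0&0\\0&0&-1\\0&1&0\end{pmatrix}$ (the infinite-amplitude limit of control pulses). **Ideal observables.** Let $v_{\ket1}=(0,0,-1)$ and $h(v)=\frac12(1-z)$. For $t_1,\tau_2,t_3>0$ define $$F_0(\theta)=\Big(h(R_{t_1}(v_{\ket1})),\ h(P_0^+(v_{\ket1})),\ h(P_0^-\circ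 R_{t_3}\circ P_0^+(v_{\ket1})),\ h(P_0^-\circ R_{2t_3}\circ P_0^+(v_{\ket1}))\Big).$$ *)

(* Defs.v *)
From HB Require Import structures.
From mathcomp Require Import all_boot all_order all_algebra.
From mathcomp Require Import all_classical all_reals all_analysis.

Set Implicit Arguments.
Unset Strict Implicit.
Unset Printing Implicit Defensive.
Import Order.TTheory GRing.Theory Num.Theory.
Import numFieldNormedType.Exports.

Local Open Scope classical_set_scope.
Local Open Scope ring_scope.

Section Diffeomorphism.
Context {R : realType}.

Definition open_box n (lo hi : 'rV[R]_n) : set 'rV[R]_n :=
  [set x | forall i, lo 0 i < x 0 i < hi 0 i].

(* [delta_mx 0 i] is the i-th standard basis vector, so the derivatives below
   are the partial derivatives. Meaningful for open [U]. *)
Fixpoint Ck_on m n (k : nat) (U : set 'rV[R]_m.+1)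
    (f : 'rV[R]_m.+1 -> 'rV[R]_n.+1) : Prop :=
  {in U, continuous f} /\
  if k is k'.+1 then
    forall i : 'I_m.+1,
      {in U, forall x, derivable f x (delta_mx 0 i)} /\
      Ck_on k' U (fun x => 'D_(delta_mx 0 i) f x)
  else True.

Definition smooth_on m n (U : set 'rV[R]_m.+1)
    (f : 'rV[R]_m.+1 -> 'rV[R]_n.+1) : Prop :=
  forall k, Ck_on k U f.

(* C^oo diffeomorphism between open subsets of Euclidean spaces; the values of
   [f] outside [U] and of its inverse [g] outside [V] are irrelevant. *)
Definition diffeomorphism m n (U : set 'rV[R]_m.+1) (V : set 'rV[R]_n.+1)
    (f : 'rV[R]_m.+1 -> 'rV[R]_n.+1) : Prop :=
  [/\ open U, open V, set_bij U V f, smooth_on U f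
    & exists g : 'rV[R]_n.+1 -> 'rV[R]_m.+1,
        {in U, cancel f g} /\ smooth_on V g].

End Diffeomorphism.

Section Qubit.
Context {R : realType}.
Implicit Types (kappa tau : R) (v : 'cV[R]_3).

Definition expmx n (A : 'M[R]_n.+1) : 'M[R]_n.+1 :=
  limn (series (fun k : nat => (k`!%:R : R)^-1 *: A ^+ k)).

Definition vec3 (x y z : R) : 'cV[R]_3 := \col_(i < 3) [:: x; y; z]`_i.

Definition mat3 (rows : seq (seq R)) : 'M[R]_3 :=
  \matrix_(i < 3, j < 3) (nth [::] rows i)`_j.

Definition A0 (gamma1 gamma2 omega : R) : 'M[R]_3 := mat3
  [:: [:: - (gamma1 / 2) - 2 * gamma2; - omega; 0];
      [:: omega; - (gamma1 / 2) - 2 * gamma2; 0];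
      [:: 0; 0; - gamma1]].

Definition drift (gamma1 : R) : 'cV[R]_3 := vec3 0 0 gamma1.

(* The vector-valued integral is taken coordinatewise. *)
Definition free_evolution (gamma1 gamma2 omega t : R) v : 'cV[R]_3 :=
  expmx (t *: A0 gamma1 gamma2 omega) *m v +
  \col_(i < 3) \int[lebesgue_measure]_(s in `[0, t])
     (expmx ((t - s) *: A0 gamma1 gamma2 omega) *m drift gamma1) i 0.

Definition Omega_x : 'M[R]_3 := mat3
  [:: [:: 0; 0; 0];
      [:: 0; 0; -1];
      [:: 0; 1; 0]].

Definition pulse_plus kappa tau v : 'cV[R]_3 :=
  expmx ((kappa * tau) *: Omega_x) *m v.

Definition pulse_minus kappa tau v : 'cV[R]_3 :=
  expmx ((- (kappa * tau)) *: Omega_x) *m v.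

Definition ket1 : 'cV[R]_3 := vec3 0 0 (-1).

(* [ord_max : 'I_3] is the index of the coordinate z. *)
Definition h v : R := (1 - v ord_max 0) / 2.

(* theta = (gamma1, kappa, gamma2, omega) *)
Definition F0 (t1 tau2 t3 : R) (theta : 'rV[R]_4) : 'rV[R]_4 :=
  let gamma1 := theta 0 (inord 0) in
  let kappa := theta 0 (inord 1) in
  let gamma2 := theta 0 (inord 2) in
  let omega := theta 0 (inord 3) in
  let Rt := free_evolution gamma1 gamma2 omega in
  let Pp := pulse_plus kappa tau2 in
  let Pm := pulse_minus kappa tau2 in
  \row_(i < 4) [:: h (Rt t1 ket1);
                   h (Pp ket1);
                   h (Pm (Rt t3 (Pp ket1)));
                   h (Pm (Rt (2 * t3) (Pp ket1)))]`_i.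

End Qubit.

(* Main.v *)
Require Import Defs.
From HB Require Import structures.
From mathcomp Require Import all_boot all_order all_algebra.
From mathcomp Require Import all_classical all_reals all_analysis.
From mathcomp Require Import ring lra.
Import Order.TTheory GRing.Theory Num.Theory.
Import numFieldNormedType.Exports.

Local Open Scope classical_set_scope.
Local Open Scope ring_scope.

(* Choose [t1 = t3 = t] and [tau] so small that [kappa * tau] and [omega * t] stay
   in ]0, pi[ on the box. Put [e = exp(-gamma1 t)], [c = cos(kappa tau)] and
   [C s = exp(-(gamma1 / 2 + 2 gamma2) s) cos(omega s)]. The four observables are
   then [e], [(1 + c) / 2], and [1/2] plus terms in [e] (resp. [e^2]) and [c] plus
   [(1 - c^2) / 2] times [C t] (resp. [C (2 t)]), so they determine [e], [c], [C t]
   and [C (2 t)]. Since [2 (C t)^2 - C (2 t) = exp(-(gamma1 + 4 gamma2) t)], all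
   parameters are recovered by [ln], [acos] and [sqrt]. The inverse so obtained is
   smooth on an explicit open set [W] on which it is also a right inverse, hence the
   image of the box is [W] intersected with the preimage of the box under it. *)

(** * Entrywise limits and the matrix exponential *)

Lemma cvg_mx {R : realType} {T : Type} {F : set_system T} {FF : Filter F} m n
    (f : T -> 'M[R]_(m, n)) (M : 'M[R]_(m, n)) :
  (forall i j, f x i j @[x --> F] --> M i j) -> f x @[x --> F] --> M.
Proof.
move=> fM; apply/cvgrPdist_le => /= e e0.
near=> x.
rewrite /Num.Def.normr/= mx_normrE (bigmax_le _ (ltW e0))//= => i _.
rewrite !mxE/=.
move: i; near: x; apply: filter_forall => /= i.
exact: ((cvgrPdist_le _ _).1 (fM i.1 i.2)).
Unshelve. all: by end_near. Qed.

Section MatrixExponential.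
Context {R : realType} {n : nat}.
Implicit Types (A : 'M[R]_n.+1) (i j : 'I_n.+1) (t : R).

(** The series is dominated by [C] times the exponential series at [c * |x|], hence converges at
    every [x]. *)
Lemma cvg_pseries_fact_bound (f : R^nat) (C c x : R) : 0 <= c ->
  (forall k, `|f k| <= C * (c ^+ k / k`!%:R)) -> cvgn (pseries f x).
Proof.
move=> c0 fle; apply: normed_cvg.
have C0 : 0 <= C by have := le_trans (normr_ge0 _) (fle 0); rewrite divr1 mulr1.
apply: (@series_le_cvg _ _ (fun k => C * exp_coeff (c * `|x|) k)) => //.
- by move=> k /=.
- by move=> k; rewrite mulr_ge0// divr_ge0// exprn_ge0// mulr_ge0.
- move=> k; rewrite /= normrM normrX /exp_coeff /= exprMn.
  rewrite [leRHS](_ : _ = C * (c ^+ k / k`!%:R) * `|x| ^+ k); last by ring.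
  by rewrite ler_wpM2r ?exprn_ge0.
- by apply: is_cvg_seriesZ; exact: is_cvg_series_exp_coeff.
Qed.

Lemma le_mx_norm A i j : `|A i j| <= `|A|.
Proof.
rewrite [leRHS]/Num.Def.normr/= mx_normrE; exact: (le_bigmax _ _ (i, j)).
Qed.

(** The norm here is the largest absolute value of an entry. Each entry of a product is a sum of
    [n.+1] terms, which costs one factor [n.+1] per multiplication. *)
Lemma le_exprmx_norm A k i j : `|(A ^+ k) i j| <= (n.+1%:R * `|A|) ^+ k.
Proof.
elim: k i j => [|k IH] i j.
  by rewrite !expr0 !mxE; case: (_ == _); rewrite /= ?normr1 ?normr0.
rewrite !exprS -[A * _]/(A *m _) mxE (le_trans (ler_norm_sum _ _ _))//.
rewrite [leRHS](_ : _ = \sum_(l < n.+1) `|A| * (n.+1%:R * `|A|) ^+ k); last first.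
  by rewrite sumr_const card_ord -mulrA mulr_natl.
apply: ler_sum => l _; rewrite normrM ler_pM//; exact: le_mx_norm.
Qed.

Let coef A i j k := (k`!%:R)^-1 * (A ^+ k) i j.

Lemma cvg_expmx_entry A i j t : cvgn (pseries (coef A i j) t).
Proof.
apply: (@cvg_pseries_fact_bound _ 1 (n.+1%:R * `|A|)); first by rewrite mulr_ge0.
move=> k; rewrite mul1r /coef normrM mulrC [`|_^-1|]ger0_norm ?invr_ge0//.
by rewrite ler_wpM2r ?invr_ge0// le_exprmx_norm.
Qed.

(** Reduces the matrix limit to scalar power series in [t], to which termwise differentiation
    applies. *)
Lemma expmxE A t i j : expmx (t *: A) i j = limn (pseries (coef A i j) t).
Proof.
rewrite /expmx.
have -> // : limn (series (fun k => k`!%:R^-1 *: (t *: A) ^+ k)) =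
  \matrix_(i, j) limn (pseries (coef A i j) t); last by rewrite mxE.
apply/cvg_lim => //; apply: cvg_mx => {}i {}j; rewrite mxE.
rewrite (_ : (fun x => _) = pseries (coef A i j) t); first exact: cvg_expmx_entry.
apply/funext => k; rewrite /pseries /series /= summxE; apply: eq_bigr => l _.
by rewrite exprZn !mxE /coef; ring.
Qed.

Lemma pseries_diffs_coef A i j :
  pseries_diffs (coef A i j) = fun k => (k`!%:R)^-1 * (A ^+ k.+1) i j.
Proof.
apply/funext => k; rewrite /pseries_diffs /coef factS natrM invfM.
by rewrite mulrA mulVKf// pnatr_eq0.
Qed.

Lemma is_derive_expmx_diffs A i j t :
  is_derive t (1 : R) (fun t => expmx (t *: A) i j)
    (limn (pseries (pseries_diffs (coef A i j)) t)).
Proof.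
rewrite (_ : (fun t => _) = fun t => limn (pseries (coef A i j) t)); last first.
  by apply/funext => u; rewrite expmxE.
have c0 : 0 <= n.+1%:R * `|A| by rewrite mulr_ge0.
(* Any radius above [|t|] would do: the series and its first two termwise derivatives converge
   everywhere. *)
apply: (@pseries_snd_diffs _ _ (`|t| + 1)).
- exact: cvg_expmx_entry.
- rewrite pseries_diffs_coef.
  apply: (@cvg_pseries_fact_bound _ (n.+1%:R * `|A|) (n.+1%:R * `|A|)) => // k.
  rewrite mulrA -exprS normrM mulrC [`|_^-1|]ger0_norm ?invr_ge0//.
  by rewrite ler_wpM2r ?invr_ge0// le_exprmx_norm.
- rewrite pseries_diffs_coef.
  rewrite (_ : pseries_diffs _ = fun k => (k`!%:R)^-1 * (A ^+ k.+2) i j).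
    apply: (@cvg_pseries_fact_bound _ ((n.+1%:R * `|A|) ^+2) (n.+1%:R * `|A|)) => // k.
    rewrite mulrA -exprD normrM mulrC [`|_^-1|]ger0_norm ?invr_ge0//.
    by rewrite ler_wpM2r ?invr_ge0// le_exprmx_norm.
  apply/funext => k; rewrite /pseries_diffs factS natrM invfM.
  by rewrite mulrA mulVKf// pnatr_eq0.
- by rewrite ltr_normr ltrDl ltr01.
Qed.

Lemma limn_pseries_sum (c : 'I_n.+1 -> R) (f : 'I_n.+1 -> R^nat) t :
  (forall l, cvgn (pseries (f l) t)) ->
  limn (pseries (fun k => \sum_l c l * f l k) t) =
  \sum_l c l * limn (pseries (f l) t).
Proof.
move=> fcvg; apply/cvg_lim => //.
rewrite (_ : pseries _ _ = fun k => \sum_l c l * pseries (f l) t k).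
  apply: cvg_big; first exact: add_continuous.
  by move=> l _; apply: cvgMr; exact: fcvg.
apply/funext => k; rewrite /pseries /series /=.
under [RHS]eq_bigr do rewrite mulr_sumr.
rewrite exchange_big /=; apply: eq_bigr => l _; rewrite mulr_suml.
by apply: eq_bigr => j _; ring.
Qed.

Lemma is_derive_expmxl A i j t :
  is_derive t (1 : R) (fun t => expmx (t *: A) i j) ((A *m expmx (t *: A)) i j).
Proof.
have := is_derive_expmx_diffs A i j t; rewrite pseries_diffs_coef.
congr (is_derive _ _ _ _); rewrite mxE.
under [RHS]eq_bigr do rewrite expmxE.
rewrite -limn_pseries_sum; last by move=> l; exact: cvg_expmx_entry.
congr (limn (pseries _ _)); apply/funext => k.
rewrite exprS -[A * _]/(A *m _) mxE mulr_sumr; apply: eq_bigr => l _.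
by rewrite /coef; ring.
Qed.

(** The same derivative with [A] split off each power on the right instead of the left. This form
    makes the two terms cancel in [mulmx_expmxN_ode]. *)
Lemma is_derive_expmxr A i j t :
  is_derive t (1 : R) (fun t => expmx (t *: A) i j) ((expmx (t *: A) *m A) i j).
Proof.
have := is_derive_expmx_diffs A i j t; rewrite pseries_diffs_coef.
congr (is_derive _ _ _ _); rewrite mxE.
under [RHS]eq_bigr do rewrite expmxE mulrC.
rewrite -limn_pseries_sum; last by move=> l; exact: cvg_expmx_entry.
congr (limn (pseries _ _)); apply/funext => k.
rewrite exprSr -[_ * A]/(_ *m A) mxE mulr_sumr; apply: eq_bigr => l _.
by rewrite /coef; ring.
Qed.

Lemma expmx0 : expmx (0 : 'M[R]_n.+1) = 1%:M.
Proof.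
(* The partial sum of index 0 is empty. From index 1 on the sums are constant, because [0 ^+ 0 = 1]
   is the only nonzero term. *)
apply/cvg_lim => //; rewrite -cvg_shiftS /=.
apply: cvg_near_cst; near=> k.
rewrite /series /= big_nat_recl//= expr0 fact0 invr1 scale1r big1 ?addr0//.
by move=> i _; rewrite expr0n /= scaler0.
Unshelve. all: by end_near. Qed.

(** Lets a closed form of an exponential be verified through its differential equation rather than
    by summing the series. *)
Definition mx_ode_solution A (V : R -> 'M[R]_n.+1) :=
  V 0 = 1%:M /\
  forall (t : R) i j, is_derive t (1 : R) (fun t => V t i j) ((A *m V t) i j).

(** By the product rule the derivative is [E *m (A *m V) - (E *m A) *m V = 0] with
    [E = expmx (- t *: A)], so the product keeps its value at 0. *)
Lemma mulmx_expmxN_ode A V t : mx_ode_solution A V ->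
  expmx (- t *: A) *m V t = 1%:M.
Proof.
move=> [V0 dV].
have E0 : expmx (- 0 *: A) *m V 0 = 1%:M.
  by rewrite oppr0 scale0r expmx0 V0 mul1mx.
apply/matrixP => i j; rewrite -[in RHS]E0.
apply: (@is_derive_0_is_cst R (fun t => (expmx (- t *: A) *m V t) i j)) => u.
rewrite (_ : (fun t => _) =
    \sum_l ((fun t => expmx (- t *: A) i l) * (fun t => V t l j))).
  have dE l : is_derive u (1 : R) (fun t => expmx (- t *: A) i l)
      (- (expmx (- u *: A) *m A) i l).
    have := is_derive1_comp (is_derive_expmxr A i l (- u)) (is_deriveNid u 1).
    by rewrite mulrN1.
  apply: is_derive_eq.
  transitivity ((expmx (- u *: A) *m (A *m V u)) i j
                - (expmx (- u *: A) *m A *m V u) i j); last first.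
    by rewrite mulmxA subrr.
  rewrite [X in _ = X - _]mxE [X in _ = _ - X]mxE -sumrB; apply: eq_bigr => l _.
  by rewrite /GRing.scale /=; ring.
by apply/funext => v; rewrite mxE fct_sumE.
Qed.

(* [t |-> expmx (- t *: A) *m V t] has zero derivative, so both [V t] and
   [expmx (t *: A)] are inverse to [expmx (- t *: A)]. *)
Lemma expmx_ode A V t : mx_ode_solution A V -> expmx (t *: A) = V t.
Proof.
move=> VA.
have EA : mx_ode_solution A (fun t => expmx (t *: A)).
  by split; [rewrite scale0r expmx0 | move=> *; exact: is_derive_expmxl].
have /mulmx1C EN := mulmx_expmxN_ode A _ t EA.
by rewrite -[RHS]mul1mx -EN -mulmxA mulmx_expmxN_ode// mulmx1.
Qed.

End MatrixExponential.

(** * Directional derivatives of real-valued functions *)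

Section DirectionalDerivative.
Context {R : realType} {V : normedModType R}.

(** Restricting to a line brings the chain rule on a normed space down to the one-variable rule. *)
Lemma is_derive_line (f : V -> R) (x v : V) (df : R) :
  is_derive x v f df <-> is_derive (0 : R) (1 : R) (fun t : R => f (t *: v + x)) df.
Proof.
have eqD : 'D_v f x = 'D_(1 : R) (fun t : R => f (t *: v + x)) 0.
  rewrite /derive; set q1 := fun t => t^-1 *: _; set q2 := fun t => t^-1 *: _.
  suff -> : q1 = q2 by [].
  apply/funext => t; rewrite /q1 /q2 /=.
  by rewrite addr0 scale0r add0r [_%:A]mulr1.
split=> -[fx <-].
- by apply: DeriveDef; [exact: (derivable1P f x v).1|rewrite eqD].
- by apply: DeriveDef; [exact: (derivable1P f x v).2|rewrite eqD].
Qed.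

Lemma is_derive_comp (phi : R -> R) (f : V -> R) (x v : V) (a b : R) :
  is_derive (f x) (1 : R) phi a -> is_derive x v f b ->
  is_derive x v (phi \o f) (a * b).
Proof.
move=> dphi /is_derive_line df; apply/is_derive_line.
by apply: (is_derive1_comp (f := phi)); rewrite ?scale0r ?add0r.
Qed.

End DirectionalDerivative.

(** Serves functions on [R] itself, where [Ck] still ranges over all directions [v]. *)
Lemma is_derive_scale {R : realType} (f : R -> R) (x v df : R) :
  is_derive x (1 : R) f df -> is_derive x v f (v * df).
Proof.
move=> [fx <-]; have dfx := (derivable1_diffP _ _).1 fx.
split; first exact: diff_derivable.
by rewrite !deriveE// -[in LHS](mulr1 v) [LHS]linearZ.
Qed.

(* Derivatives in all directions, given by witnesses rather than by ['D_v]: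
   closure properties then need no rewriting under the derivative. *)
Fixpoint Ck {R : realType} {V : normedModType R} (k : nat) (U : set V)
    (f : V -> R) : Prop :=
  {in U, continuous f} /\
  if k is k'.+1 then
    forall v, exists g, {in U, forall x, is_derive x v f (g x)} /\ Ck k' U g
  else True.

Definition smooth {R : realType} {V : normedModType R} (U : set V) (f : V -> R) :=
  forall k, Ck k U f.

(** * Closure of smooth functions under restriction, arithmetic and composition *)

Section SmoothFunctions.
Context {R : realType} {V : normedModType R}.
Implicit Types (U : set V) (f g : V -> R) (k : nat).

Lemma Ck_continuous k U f : Ck k U f -> {in U, continuous f}.
Proof. by case: k => [|k] []. Qed.

Lemma Ck_pred k U f : Ck k.+1 U f -> Ck k U f.
Proof.
elim: k f => [|k IH] f [cf df]; split=> // v.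
by have [g [fg /IH]] := df v; exists g.
Qed.

Lemma Ck_subset k U U' f : U' `<=` U -> Ck k U f -> Ck k U' f.
Proof.
move=> U'U; elim: k f => [|k IH] f [cf df].
  by split=> // x xU'; apply: cf; move: xU'; rewrite !inE => /U'U.
split=> [x|v]; first by rewrite inE => /U'U xU; apply: cf; rewrite inE.
have [g [fg /IH gU]] := df v; exists g; split=> // x.
by rewrite inE => /U'U xU; apply: fg; rewrite inE.
Qed.

(** Since [U] is open, equality on [U] holds near each of its points, so limits and derivatives
    agree there. *)
Lemma eq_Ck k U f g : open U -> {in U, f =1 g} -> Ck k U f -> Ck k U g.
Proof.
move=> oU fg.
have nfg x : x \in U -> \near x, f x = g x.
  rewrite inE => xU; near=> y; apply: fg; rewrite inE; near: y.
  exact: open_nbhs_nbhs.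
case: k => [|k] [cf df]; split=> //.
- move=> x xU; rewrite /continuous_at /prop_for -fg//.
  by apply: cvg_trans (cf x xU); apply: near_eq_cvg; exact: nfg.
- move=> x xU; rewrite /continuous_at /prop_for -fg//.
  by apply: cvg_trans (cf x xU); apply: near_eq_cvg; exact: nfg.
- move=> v; have [f' [ff' f'U]] := df v; exists f'; split=> // x xU.
  by apply: near_eq_is_derive (ff' x xU); exact: nfg.
Unshelve. all: by end_near. Qed.

Lemma Ck_cst k U c : Ck k U (cst c).
Proof.
elim: k c => [|k IH] c; split=> //; try by move=> x _; exact: cst_continuous.
by move=> v; exists (cst 0); split=> // x _; exact: is_derive_cst.
Qed.

Lemma CkD k U f g : Ck k U f -> Ck k U g -> Ck k U (fun x => f x + g x).
Proof.
elim: k f g => [|k IH] f g [cf df] [cg dg]; split=> //.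
- by move=> x xU; apply: cvgD; [exact: cf|exact: cg].
- by move=> x xU; apply: cvgD; [exact: cf|exact: cg].
- move=> v; have [f' [ff' f'U]] := df v; have [g' [gg' g'U]] := dg v.
  exists (fun x => f' x + g' x); split; last exact: IH.
  by move=> x xU; apply: is_deriveD; [exact: ff'|exact: gg'].
Qed.

Lemma CkM k U f g : Ck k U f -> Ck k U g -> Ck k U (fun x => f x * g x).
Proof.
elim: k f g => [|k IH] f g [cf df] [cg dg]; split=> //.
- by move=> x xU; apply: cvgM; [exact: cf|exact: cg].
- by move=> x xU; apply: cvgM; [exact: cf|exact: cg].
- move=> v; have [f' [ff' f'U]] := df v; have [g' [gg' g'U]] := dg v.
  exists (fun x => f x * g' x + g x * f' x); split; last first.
    by apply: CkD; apply: IH => //; apply: Ck_pred; split.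
  by move=> x xU; apply: is_deriveM; [exact: ff'|exact: gg'].
Qed.

(** Induction on [k]: the derivative [phi' (f x) * f' x] is a product of functions of order [k],
    where [f] itself is first lowered by [Ck_pred]. *)
Lemma Ck_comp k (W : set R) U (phi : R -> R) f :
  (forall x, U x -> W (f x)) -> Ck k W phi -> Ck k U f -> Ck k U (phi \o f).
Proof.
move=> fW; have fWi x : x \in U -> f x \in W by rewrite !inE; exact: fW.
elim: k phi f fW fWi => [|k IH] phi f fW fWi [cphi dphi] [cf df]; split=> //.
- by move=> x xU; apply: continuous_comp; [exact: cf|exact/cphi/fWi].
- by move=> x xU; apply: continuous_comp; [exact: cf|exact/cphi/fWi].
- move=> v; have [f' [ff' f'U]] := df v; have [phi' [phiphi' phi'W]] := dphi 1.
  exists (fun x => phi' (f x) * f' x); split; last first.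
    by apply: CkM => //; apply: IH => //; apply: Ck_pred; split.
  by move=> x xU; apply: is_derive_comp; [exact/phiphi'/fWi|exact: ff'].
Qed.

Lemma smooth_subset U U' f : U' `<=` U -> smooth U f -> smooth U' f.
Proof. by move=> U'U fU k; exact: Ck_subset (fU k). Qed.

Lemma smooth_cst U c : smooth U (fun=> c).
Proof. by move=> k; exact: Ck_cst. Qed.

Lemma smoothD U f g : smooth U f -> smooth U g -> smooth U (fun x => f x + g x).
Proof. by move=> fU gU k; exact: CkD. Qed.

Lemma smoothM U f g : smooth U f -> smooth U g -> smooth U (fun x => f x * g x).
Proof. by move=> fU gU k; exact: CkM. Qed.

Lemma smoothN U f : smooth U f -> smooth U (fun x => - f x).
Proof.
move=> fU; rewrite (_ : (fun x => _) = fun x => -1 * f x).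
  by apply: smoothM => //; exact: smooth_cst.
by apply/funext => x; rewrite mulN1r.
Qed.

Lemma smoothB U f g : smooth U f -> smooth U g -> smooth U (fun x => f x - g x).
Proof. by move=> fU gU; apply: smoothD => //; exact: smoothN. Qed.

Lemma smoothX U f n : smooth U f -> smooth U (fun x => f x ^+ n).
Proof.
move=> fU; elim: n => [|n IH].
  by rewrite (_ : (fun x => _) = fun=> 1)//; exact: smooth_cst.
rewrite (_ : (fun x => _) = fun x => f x * f x ^+ n); first exact: smoothM.
by apply/funext => x; rewrite exprS.
Qed.

Lemma smooth_comp (W : set R) (phi : R -> R) U f :
  smooth W phi -> (forall x, U x -> W (f x)) -> smooth U f ->
  smooth U (fun x => phi (f x)).
Proof. by move=> phiW fW fU k; exact: (Ck_comp _ _ _ _ _ fW (phiW k) (fU k)). Qed.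

End SmoothFunctions.

(** * Smoothness of the elementary functions *)

Section SmoothRealFunctions.
Context {R : realType}.
Implicit Types (W : set R) (phi : R -> R).

Lemma CkS_derive1 k W phi phi' :
  (forall x, W x -> is_derive x (1 : R) phi (phi' x)) -> Ck k W phi' ->
  Ck k.+1 W phi.
Proof.
move=> dphi phi'W; split.
  move=> x; rewrite inE => xW; apply/differentiable_continuous/derivable1_diffP.
  by have [] := dphi x xW.
move=> v; exists (fun x => v * phi' x); split; last exact: CkM (Ck_cst _ _ _) _.
by move=> x; rewrite inE => /dphi; exact: is_derive_scale.
Qed.

(** A bootstrap for functions whose derivative is built from the function itself, such as [expR] and
    the inverse: regularity of [phi] passes to [phi'] and comes back one order higher. *)
Lemma smooth_derive1 W phi phi' :
  (forall x, W x -> is_derive x (1 : R) phi (phi' x)) ->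
  (forall k, Ck k W phi -> Ck k W phi') -> smooth W phi.
Proof.
move=> dphi phi'W; elim=> [|k IH]; last exact: CkS_derive1 (phi'W _ IH).
split=> // x; rewrite inE => xW.
by apply/differentiable_continuous/derivable1_diffP; have [] := dphi x xW.
Qed.

Lemma smooth_id W : smooth W id.
Proof. by apply: smooth_derive1 => // k _; exact: Ck_cst. Qed.

Lemma smooth_expR W : smooth W expR.
Proof. exact: smooth_derive1. Qed.

Lemma smooth_cos W : smooth W cos.
Proof.
(* Each of the two is up to sign the derivative of the other, so they are treated in one
   induction. *)
suff cs k : Ck k W cos /\ Ck k W sin by move=> k; case: (cs k).
elim: k => [|k [Ckcos Cksin]].
  by split; split=> // x _; [exact: continuous_cos|exact: continuous_sin].
split; last exact: CkS_derive1 Ckcos.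
apply: (@CkS_derive1 _ _ _ (fun x => - sin x)).
rewrite (_ : (fun x => _) = fun x => -1 * sin x).
  exact: CkM (Ck_cst _ _ _) Cksin.
by apply/funext => x; rewrite mulN1r.
Qed.

Lemma smooth_inv : smooth [set x : R | 0 < x] (fun x => x^-1).
Proof.
apply: (@smooth_derive1 _ _ (fun x => -1 * (x^-1 * x^-1))).
  move=> x x0.
  apply: is_derive_eq.
    exact: (@is_deriveV _ id x 1 1 (lt0r_neq0 x0) (is_derive_id x 1)).
  by rewrite /GRing.scale /= mulr1 expr2 invfM mulN1r.
by move=> k Ckinv; apply: CkM (Ck_cst _ _ _) _; exact: CkM.
Qed.

Lemma smooth_ln : smooth [set x : R | 0 < x] (@ln R).
Proof.
case=> [|k]; first split=> // x.
  rewrite inE => x0; exact: continuous_ln.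
apply: CkS_derive1 (smooth_inv k) => x; exact: is_derive1_ln.
Qed.

Lemma smooth_sqrt : smooth [set x : R | 0 < x] Num.sqrt.
Proof.
elim=> [|k IH]; first by split=> // x _; exact: sqrt_continuous.
apply: (@CkS_derive1 _ _ _ (fun x => (2 * Num.sqrt x)^-1)).
apply: (@Ck_comp _ _ _ [set x | 0 < x] _ (fun x => x^-1)).
- by move=> x /=; rewrite -sqrtr_gt0 => ?; rewrite mulr_gt0.
- exact: smooth_inv.
- exact: CkM (Ck_cst _ _ _) IH.
Qed.

Lemma smooth_acos : smooth [set x : R | -1 < x < 1] acos.
Proof.
case=> [|k]; first by split=> // x; rewrite inE; exact: continuous_acos.
apply: (@CkS_derive1 _ _ _ (fun x => - (Num.sqrt (1 - x ^+ 2))^-1)).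
have sqrt_arg x : -1 < x < 1 -> 0 < 1 - x ^+ 2 :> R by move=> /andP[? ?]; nra.
apply: smoothN; apply: smooth_comp smooth_inv _ _ => /=.
  by move=> x /sqrt_arg; rewrite sqrtr_gt0.
apply: smooth_comp smooth_sqrt _ _ => /=; first exact: sqrt_arg.
by apply: smoothB; [exact: smooth_cst|apply: smoothX; exact: smooth_id].
Qed.

End SmoothRealFunctions.

(** * From real-valued coordinates to row-valued maps *)

Lemma smooth_coord {R : realType} m (U : set 'rV[R]_m) (j : 'I_m) :
  smooth U (fun x => x 0 j).
Proof.
case=> [|k]; first by split=> // x _; exact: coord_continuous.
split=> [x _|v]; first exact: coord_continuous.
exists (cst (v 0 j)); split; last exact: Ck_cst.
move=> x _; apply/is_derive_line.
rewrite (_ : (fun t : R => _) = fun t => t * v 0 j + x 0 j); last first.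
  by apply/funext => t; rewrite !mxE.
apply: is_derive_eq.
by rewrite /GRing.scale /=; ring.
Qed.

(** Links the witness-based [Ck] to [Ck_on]: a partial derivative of [f] has as coordinates the
    partial derivatives of its coordinates, which equal the witnesses on the open set [U]. *)
Lemma Ck_on_row {R : realType} m n k (U : set 'rV[R]_m.+1)
    (f : 'rV[R]_m.+1 -> 'rV[R]_n.+1) : open U ->
  (forall j, Ck k U (fun x => f x 0 j)) -> Ck_on k U f.
Proof.
move=> oU; elim: k f => [|k IH] f fU; split=> //.
- move=> x xU; apply: (@cvg_mx _ _ (nbhs x) (nbhs_filter x)) => i j; rewrite (ord1 i).
  exact: Ck_continuous (fU j) x xU.
- move=> x xU; apply: (@cvg_mx _ _ (nbhs x) (nbhs_filter x)) => i j; rewrite (ord1 i).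
  exact: Ck_continuous (fU j) x xU.
- move=> i.
  have fd : {in U, forall x, derivable f x (delta_mx 0 i)}.
    move=> x xU; apply/derivable_mxP => a j; rewrite (ord1 a).
    by have [_ /(_ (delta_mx 0 i))[g [/(_ x xU)[]]]] := fU j.
  split=> //; apply: IH => j.
  have [_ /(_ (delta_mx 0 i))[g [fg gU]]] := fU j.
  apply: eq_Ck gU => // x xU; rewrite derive_mx ?mxE; last exact: fd.
  by have [_ ->] := fg x xU.
Qed.

Lemma smooth_on_row {R : realType} m n (U : set 'rV[R]_m.+1)
    (f : 'rV[R]_m.+1 -> 'rV[R]_n.+1) : open U ->
  (forall j, smooth U (fun x => f x 0 j)) -> smooth_on U f.
Proof. by move=> oU fU k; apply: Ck_on_row => // j; exact: fU. Qed.

Lemma smooth_on_continuous {R : realType} m n (U : set 'rV[R]_m.+1)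
    (f : 'rV[R]_m.+1 -> 'rV[R]_n.+1) : smooth_on U f -> {in U, continuous f}.
Proof. by move=> /(_ 0) []. Qed.

(** * Closed forms of the evolution, the pulses and the observables *)

Section BlochDynamics.
Context {R : realType}.
Implicit Types (omega kappa tau t x y z : R).

Lemma mat3M_vec3 (a b c d e f g h i x y z : R) :
  mat3 [:: [:: a; b; c]; [:: d; e; f]; [:: g; h; i]] *m vec3 x y z =
  vec3 (a * x + b * y + c * z) (d * x + e * y + f * z) (g * x + h * y + i * z).
Proof.
apply/matrixP => -[[|[|[|//]]] ?] ?; rewrite !mxE !big_ord_recr big_ord0 /= !mxE /=;
  by rewrite add0r.
Qed.

Lemma is_derive_expR_lin (c t : R) :
  is_derive t (1 : R) (fun t => expR (c * t)) (c * expR (c * t)).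
Proof.
have dl : is_derive t (1 : R) (fun t => c * t) c.
  by apply: is_derive_eq; rewrite /GRing.scale /= mulr1.
by have := is_derive1_comp (is_derive_expR (c * t)) dl; rewrite mulrC.
Qed.

Lemma is_derive_cos_lin (c t : R) :
  is_derive t (1 : R) (fun t => cos (c * t)) (- c * sin (c * t)).
Proof.
have dl : is_derive t (1 : R) (fun t => c * t) c.
  by apply: is_derive_eq; rewrite /GRing.scale /= mulr1.
by have := is_derive1_comp (is_derive_cos (c * t)) dl; rewrite mulrC mulrN mulNr.
Qed.

Lemma is_derive_sin_lin (c t : R) :
  is_derive t (1 : R) (fun t => sin (c * t)) (c * cos (c * t)).
Proof.
have dl : is_derive t (1 : R) (fun t => c * t) c.
  by apply: is_derive_eq; rewrite /GRing.scale /= mulr1.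
by have := is_derive1_comp (is_derive_sin (c * t)) dl; rewrite mulrC.
Qed.

(** [A0] is block diagonal: a damped rotation in the plane of x and y, and a scalar decay along
    z. *)
Lemma expmx_A0 (gamma1 gamma2 : R) omega t :
  let E := expR (- (gamma1 / 2 + 2 * gamma2) * t) in
  expmx (t *: A0 gamma1 gamma2 omega) = mat3
    [:: [:: E * cos (omega * t); - (E * sin (omega * t)); 0];
        [:: E * sin (omega * t); E * cos (omega * t); 0];
        [:: 0; 0; expR (- gamma1 * t)]].
Proof.
set G := gamma1 / 2 + 2 * gamma2 => /=.
apply: (@expmx_ode _ _ _ (fun t => mat3
    [:: [:: expR (- G * t) * cos (omega * t);
            - (expR (- G * t) * sin (omega * t)); 0];
        [:: expR (- G * t) * sin (omega * t);
            expR (- G * t) * cos (omega * t); 0];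
        [:: 0; 0; expR (- gamma1 * t)]])).
split=> [|{}t i j].
  apply/matrixP => -[[|[|[|//]]] ?] [[|[|[|//]]] ?]; rewrite !mxE /=;
    by rewrite ?mulr0 ?expR0 ?cos0 ?sin0 ?mulr1 ?mulr0 ?oppr0.
rewrite !mxE !big_ord_recr big_ord0 /= !mxE /=.
under eq_fun do rewrite mxE.
have dE := is_derive_expR_lin (- G) t.
have dc := is_derive_cos_lin omega t.
have ds := is_derive_sin_lin omega t.
have dz := is_derive_expR_lin (- gamma1) t.
case: i j => -[|[|[|//]]] ? [[|[|[|//]]] ?] /=.
all: apply: is_derive_eq; rewrite /GRing.scale /= /G; by field.
Qed.

Lemma expmx_Omega_x t :
  expmx (t *: Omega_x) = mat3
    [:: [:: 1; 0; 0]; [:: 0; cos t; - sin t]; [:: 0; sin t; cos t]].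
Proof.
apply: (@expmx_ode _ _ _ (fun t => mat3
    [:: [:: 1; 0; 0]; [:: 0; cos t; - sin t]; [:: 0; sin t; cos t]])).
split=> [|{}t i j].
  apply/matrixP => -[[|[|[|//]]] ?] [[|[|[|//]]] ?]; rewrite !mxE /=;
    by rewrite ?cos0 ?sin0 ?oppr0.
rewrite !mxE !big_ord_recr big_ord0 /= !mxE /=.
under eq_fun do rewrite mxE.
case: i j => -[|[|[|//]]] ? [[|[|[|//]]] ?] /=.
all: apply: is_derive_eq; rewrite /GRing.scale /=; ring.
Qed.

Lemma Rintegral_relaxation (gamma1 : R) t : 0 < t ->
  \int[lebesgue_measure]_(s in `[0, t]) (expR (- gamma1 * (t - s)) * gamma1) =
  1 - expR (- gamma1 * t).
Proof.
move=> t0.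
(* The integrand has the antiderivative [expR (- gamma1 * (t - s))], which equals 1 at [s = t]. *)
have dF (s : R) : is_derive s (1 : R) (fun s => expR (- gamma1 * (t - s)))
    (expR (- gamma1 * (t - s)) * gamma1).
  have dl : is_derive s (1 : R) (fun s => - gamma1 * (t - s)) gamma1.
    by apply: is_derive_eq; rewrite /GRing.scale /=; ring.
  exact: is_derive1_comp (is_derive_expR _) dl.
have cF : continuous (fun s : R => expR (- gamma1 * (t - s))).
  by move=> s; apply/differentiable_continuous/derivable1_diffP; have [] := dF s.
rewrite /Rintegral (@continuous_FTC2 _ _ (fun s => expR (- gamma1 * (t - s))))//.
- by rewrite subrr mulr0 expR0 subr0.
- apply: continuous_subspaceT => s; apply: cvgM; [exact: cF|exact: cvg_cst].
- split=> [s _||]; first by have [] := dF s.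
  + exact/cvg_at_right_filter/cF.
  + exact/cvg_at_left_filter/cF.
- by move=> s _; rewrite derive1E; have [_ ->] := dF s.
Qed.

(** The drift points along z, which [A0] does not couple to x and y. The integral thus contributes
    only to z, whose distance to the equilibrium 1 decays. *)
Lemma free_evolutionE (gamma1 gamma2 : R) omega t x y z : 0 < t ->
  let E := expR (- (gamma1 / 2 + 2 * gamma2) * t) in
  free_evolution gamma1 gamma2 omega t (vec3 x y z) =
  vec3 (E * (cos (omega * t) * x - sin (omega * t) * y))
       (E * (sin (omega * t) * x + cos (omega * t) * y))
       (1 - (1 - z) * expR (- gamma1 * t)).
Proof.
move=> t0 E; rewrite /free_evolution expmx_A0 -/E mat3M_vec3.
apply/matrixP => i j; rewrite [LHS]mxE [X in _ + X]mxE.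
under eq_Rintegral do rewrite expmx_A0 mat3M_vec3 mxE.
rewrite !mxE.
case: i => -[|[|[|//]]] ? /=.
- under eq_Rintegral do rewrite !mulr0 mul0r !addr0.
  by rewrite Rintegral_cst//; ring.
- under eq_Rintegral do rewrite !mulr0 mul0r !addr0.
  by rewrite Rintegral_cst//; ring.
- under eq_Rintegral do rewrite !mul0r !add0r.
  by rewrite Rintegral_relaxation//; ring.
Qed.

Lemma pulse_plusE kappa tau x y z (a := kappa * tau) :
  pulse_plus kappa tau (vec3 x y z) =
  vec3 x (cos a * y - sin a * z) (sin a * y + cos a * z).
Proof.
by rewrite /pulse_plus expmx_Omega_x mat3M_vec3; congr vec3; rewrite /a; ring.
Qed.

Lemma pulse_minusE kappa tau x y z (a := kappa * tau) :
  pulse_minus kappa tau (vec3 x y z) =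
  vec3 x (cos a * y + sin a * z) (cos a * z - sin a * y).
Proof.
rewrite /pulse_minus expmx_Omega_x mat3M_vec3 cosN sinN.
by congr vec3; rewrite /a; ring.
Qed.

Lemma h_vec3 x y z : h (vec3 x y z) = (1 - z) / 2.
Proof. by rewrite /h mxE. Qed.

(* The observable after a pulse of angle [acos c], a free evolution and the
   inverse pulse, where the evolution shrinks the deviation of [z] from
   equilibrium by [e] and multiplies [y] by [C] (when [x = 0]). *)
Definition echo (e c C : R) : R :=
  (1 + (1 - c ^+ 2) * C - c * (1 - (1 + c) * e)) / 2.

Definition damped_cos (gamma1 gamma2 : R) omega t : R :=
  expR (- (gamma1 / 2 + 2 * gamma2) * t) * cos (omega * t).

(** With [a = kappa * tau], the first pulse yields [x = 0], [y = sin a], [z = - cos a]. The inverse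
    pulse multiplies y by [sin a] once more, so only [sin a ^+ 2 = 1 - c ^+ 2] appears. *)
Lemma h_echo (gamma1 : R) kappa (gamma2 : R) omega tau t : 0 < t ->
  h (pulse_minus kappa tau (free_evolution gamma1 gamma2 omega t
      (pulse_plus kappa tau ket1))) =
  echo (expR (- gamma1 * t)) (cos (kappa * tau))
    (damped_cos gamma1 gamma2 omega t).
Proof.
move=> t0; rewrite /ket1 pulse_plusE free_evolutionE// pulse_minusE h_vec3.
rewrite /echo /damped_cos -sin2cos2; by field.
Qed.

Lemma F0E t tau (theta : 'rV[R]_4) : 0 < t ->
  let gamma1 := theta 0 (inord 0) in
  let kappa := theta 0 (inord 1) in
  let gamma2 := theta 0 (inord 2) in
  let omega := theta 0 (inord 3) in
  F0 t tau t theta = \row_(i < 4)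
    [:: expR (- gamma1 * t);
        (1 + cos (kappa * tau)) / 2;
        echo (expR (- gamma1 * t)) (cos (kappa * tau))
          (damped_cos gamma1 gamma2 omega t);
        echo (expR (- gamma1 * (2 * t))) (cos (kappa * tau))
          (damped_cos gamma1 gamma2 omega (2 * t))]`_i.
Proof.
move=> t0 gamma1 kappa gamma2 omega.
have t20 : 0 < 2 * t by rewrite mulr_gt0.
apply/rowP => j; rewrite [LHS]mxE [RHS]mxE -/gamma1 -/kappa -/gamma2 -/omega.
case: j => -[|[|[|[|//]]]] ? /=.
- by rewrite /ket1 free_evolutionE// h_vec3; field.
- by rewrite /ket1 pulse_plusE h_vec3; congr (_ / _); ring.
- exact: h_echo.
- exact: h_echo.
Qed.

End BlochDynamics.

(** * Arithmetic smoothness, open sets and elementary bounds *)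

Ltac smooth_arith := repeat first
  [ exact: smooth_cst | exact: smooth_coord | exact: smooth_id
  | apply: smoothX | apply: smoothN | apply: smoothD | apply: smoothM ].

Lemma open_open_box {R : realType} n (lo hi : 'rV[R]_n) : open (open_box lo hi).
Proof.
rewrite openE => x xlh; rewrite /interior /=.
pose between i (y : 'rV[R]_n) := lo 0 i < y 0 i < hi 0 i.
have allb := @filter_forall _ _ between _ (nbhs_filter x); apply: allb => i.
have /andP[lox xhi] := xlh i.
near=> y; apply/andP; split; near: y.
- by apply: cvgr_gt lox; exact: coord_continuous.
- by apply: cvgr_lt xhi; exact: coord_continuous.
Unshelve. all: by end_near. Qed.

Lemma open_setI_preimage {T S : topologicalType} (f : T -> S) (W : set T) (U : set S) :
  open W -> open U -> {in W, continuous f} -> open (W `&` f @^-1` U).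
Proof.
move=> oW oU cf; rewrite openE => x [Wx Ux]; apply: filterI.
  exact: open_nbhs_nbhs.
by apply: cf; [rewrite inE|exact: open_nbhs_nbhs].
Qed.

(** Cauchy-Schwarz: with [s ^+ 2 = 1 - c ^+ 2], the quantity [s ^+ 2 * C - c * z] is the inner
    product of the unit vector [(s, -c)] with the Bloch components [(s * C, z)] after the evolution.
    The latter lie strictly inside the unit ball. *)
Lemma echo_in01 {R : realType} (e c C : R) : 0 < e < 1 -> -1 < c < 1 ->
  C ^+ 2 <= e -> 0 < echo e c C < 1.
Proof.
move=> /andP[e0 e1] /andP[c0 c1] Ce.
pose z := 1 - (1 + c) * e.
have H : ((1 - c ^+ 2) * C - c * z) ^+ 2 < 1.
  have CS : ((1 - c ^+ 2) * C - c * z) ^+ 2 <= (1 - c ^+ 2) * C ^+ 2 + z ^+ 2.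
    rewrite -subr_ge0.
    rewrite (_ : _ - _ = (1 - c ^+ 2) * (z + c * C) ^+ 2); last by ring.
    by rewrite mulr_ge0 ?sqr_ge0//; nra.
  apply: le_lt_trans CS _.
  apply: (@le_lt_trans _ _ ((1 - c ^+ 2) * e + z ^+ 2)).
    by rewrite lerD2r ler_wpM2l//; nra.
  rewrite -subr_gt0 (_ : _ - _ = (1 + c) ^+ 2 * (e * (1 - e))).
    by rewrite mulr_gt0 ?exprn_gt0 ?mulr_gt0//; lra.
  by rewrite /z; ring.
rewrite /echo -/z; apply/andP; split; nra.
Qed.

Lemma ln_sqrt {R : realType} (x : R) : 0 < x -> ln (Num.sqrt x) = ln x / 2.
Proof.
move=> x0; rewrite -[in RHS](sqr_sqrtr (ltW x0)) lnXn ?sqrtr_gt0//.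
by rewrite -mulr_natl; field.
Qed.

(** * The explicit inverse, its domain, and the two cancellation laws *)

Section Inverse.
Context {R : realType}.
Variables (t tau : R).
Hypotheses (t0 : 0 < t) (tau0 : 0 < tau).
Let y_ (k : nat) (y : 'rV[R]_4) := y 0 (inord k).

Definition cos_angle (y : 'rV[R]_4) : R := 2 * y_ 1 y - 1.
Definition sin_angle2 (y : 'rV[R]_4) : R := 1 - cos_angle y ^+ 2.

(* Solving [echo e c C] for [(1 - c ^+ 2) * C]. *)
Definition echo_amplitude (e c f : R) : R := 2 * f - 1 + c * (1 - (1 + c) * e).

Definition amplitude1 (y : 'rV[R]_4) : R :=
  echo_amplitude (y_ 0 y) (cos_angle y) (y_ 2 y).
Definition amplitude2 (y : 'rV[R]_4) : R :=
  echo_amplitude (y_ 0 y ^+ 2) (cos_angle y) (y_ 3 y).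

(* By [cos (2 * x) = 2 * cos x ^+ 2 - 1], this is the square of
   [sin_angle2 y * expR (- (gamma1 / 2 + 2 * gamma2) * t)]. *)
Definition envelope2 (y : 'rV[R]_4) : R :=
  2 * amplitude1 y ^+ 2 - sin_angle2 y * amplitude2 y.

(** [decay] is the transverse rate [gamma1 / 2 + 2 * gamma2], and the last [acos] is applied to
    [cos (omega * t)]. *)
Definition F0_inverse (y : 'rV[R]_4) : 'rV[R]_4 :=
  let gamma1 := - ln (y_ 0 y) / t in
  let decay := (ln (sin_angle2 y) - ln (envelope2 y) / 2) / t in
  \row_(i < 4) [:: gamma1;
                   acos (cos_angle y) / tau;
                   (decay - gamma1 / 2) / 2;
                   acos (amplitude1 y / Num.sqrt (envelope2 y)) / t]`_i.

(** These inequalities place every argument of [ln], [sqrt] and [acos] where the function is smooth.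
    The last one gives both [0 < envelope2 y] and an [acos] argument strictly between -1 and 1. *)
Definition F0_domain : set 'rV[R]_4 :=
  [set y | [/\ 0 < y_ 0 y, 0 < y_ 1 y, y_ 1 y < 1 &
               amplitude1 y ^+ 2 < envelope2 y]].

Lemma smooth_amplitude1 W : smooth W amplitude1.
Proof. by rewrite /amplitude1 /echo_amplitude /cos_angle; smooth_arith. Qed.

Lemma smooth_sin_angle2 W : smooth W sin_angle2.
Proof. by rewrite /sin_angle2 /cos_angle; smooth_arith. Qed.

Lemma smooth_envelope2 W : smooth W envelope2.
Proof.
rewrite /envelope2 /amplitude2 /amplitude1 /sin_angle2 /echo_amplitude /cos_angle.
smooth_arith.
Qed.

Lemma sin_angle2_gt0 y : F0_domain y -> 0 < sin_angle2 y.
Proof. by move=> [_ y0 y1 _]; rewrite /sin_angle2 /cos_angle; nra. Qed.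

Lemma envelope2_gt0 y : F0_domain y -> 0 < envelope2 y.
Proof. by move=> [_ _ _]; apply: le_lt_trans; exact: sqr_ge0. Qed.

Lemma amplitude_ratio y : F0_domain y ->
  -1 < amplitude1 y / Num.sqrt (envelope2 y) < 1.
Proof.
move=> Wy; have e0 := envelope2_gt0 y Wy; have [_ _ _ ae] := Wy.
rewrite -ltr_norml normrM normfV [`|Num.sqrt _|]ger0_norm ?sqrtr_ge0//.
by rewrite ltr_pdivrMr ?sqrtr_gt0// mul1r -sqrtr_sqr ltr_sqrt.
Qed.

Lemma open_F0_domain : open F0_domain.
Proof.
have op (f : 'rV[R]_4 -> R) : smooth setT f -> open [set y | 0 < f y].
  move=> /(_ 0) [cf _]; apply: (@open_comp _ _ f [set x | 0 < x]).
    by move=> x _; apply: cf; rewrite inE.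
  exact: open_gt.
rewrite (_ : F0_domain = [set y | 0 < y_ 0 y] `&` [set y | 0 < y_ 1 y] `&`
    [set y | 0 < 1 - y_ 1 y] `&` [set y | 0 < envelope2 y - amplitude1 y ^+ 2]).
  do 3?apply: openI; apply: op; [exact: smooth_coord|exact: smooth_coord| |].
    by rewrite /y_; smooth_arith.
  apply: smoothB; first exact: smooth_envelope2.
  by apply: smoothX; exact: smooth_amplitude1.
apply/seteqP; split=> y; rewrite /F0_domain /= !subr_gt0.
  by case.
by move=> [[[]]].
Qed.

Lemma smooth_F0_inverse j : smooth F0_domain (fun y => F0_inverse y 0 j).
Proof.
have sln0 : smooth F0_domain (fun y => ln (y_ 0 y)).
  by apply: smooth_comp smooth_ln _ _; [move=> y []|exact: smooth_coord].
have slns : smooth F0_domain (fun y => ln (sin_angle2 y)).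
  apply: smooth_comp smooth_ln _ _; [exact: sin_angle2_gt0|].
  exact: smooth_sin_angle2.
have slne : smooth F0_domain (fun y => ln (envelope2 y)).
  apply: smooth_comp smooth_ln _ _; [exact: envelope2_gt0|].
  exact: smooth_envelope2.
have sac : smooth F0_domain (fun y => acos (cos_angle y)).
  apply: smooth_comp smooth_acos _ _.
    by move=> y [_ y0 y1 _] /=; rewrite /cos_angle; apply/andP; split; lra.
  by rewrite /cos_angle; smooth_arith.
have saa : smooth F0_domain (fun y => acos (amplitude1 y / Num.sqrt (envelope2 y))).
  apply: smooth_comp smooth_acos amplitude_ratio _.
  apply: smoothM; first exact: smooth_amplitude1.
  apply: smooth_comp smooth_inv _ _.
    by move=> y /envelope2_gt0 /=; rewrite sqrtr_gt0.
  by apply: smooth_comp smooth_sqrt envelope2_gt0 _; exact: smooth_envelope2.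
under eq_fun do rewrite mxE.
case: j => -[|[|[|[|//]]]] ?.
all: rewrite /=; repeat first [exact: smooth_cst | assumption
  | apply: smoothN | apply: smoothD | apply: smoothM ].
Qed.

Lemma smooth_F0 (W : set 'rV[R]_4) j : smooth W (fun theta => F0 t tau t theta 0 j).
Proof.
have sexp (f : 'rV[R]_4 -> R) : smooth W f -> smooth W (fun x => expR (f x)).
  exact: smooth_comp (smooth_expR setT) _.
have scos (f : 'rV[R]_4 -> R) : smooth W f -> smooth W (fun x => cos (f x)).
  exact: smooth_comp (smooth_cos setT) _.
under eq_fun do rewrite F0E// mxE.
case: j => -[|[|[|[|//]]]] ?; rewrite /= /echo /damped_cos.
all: repeat first [exact: smooth_cst | exact: smooth_coord | apply: sexp
  | apply: scos | apply: smoothX | apply: smoothN | apply: smoothD | apply: smoothM].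
Qed.

Lemma F0_cos_angle theta : cos_angle (F0 t tau t theta) = cos (theta 0 (inord 1) * tau).
Proof. by rewrite /cos_angle /y_ F0E// mxE inordK//=; field. Qed.

Lemma echoK e c C : echo_amplitude e c (echo e c C) = (1 - c ^+ 2) * C.
Proof. by rewrite /echo_amplitude /echo; field. Qed.

Lemma echo_amplitudeK e c f : c ^+ 2 != 1 ->
  echo e c (echo_amplitude e c f / (1 - c ^+ 2)) = f.
Proof.
move=> c1; rewrite /echo_amplitude /echo; field.
by rewrite subr_eq0 eq_sym.
Qed.

(** The double angle formula, as the damping factor at [2 * t] is the square of that at [t]. It
    makes [omega] drop out of [envelope2]. *)
Lemma damped_cos2 (gamma1 gamma2 omega : R) :
  damped_cos gamma1 gamma2 omega (2 * t) =
  2 * damped_cos gamma1 gamma2 omega t ^+ 2 -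
  expR (- (gamma1 / 2 + 2 * gamma2) * t) ^+ 2.
Proof.
rewrite /damped_cos -expRM_natl.
rewrite (_ : omega * (2 * t) = (omega * t) *+ 2); last by rewrite -mulr_natl; ring.
rewrite cos_mulr2n exprMn -expRM_natl.
rewrite (_ : - _ * (2 * t) = 2 * (- (gamma1 / 2 + 2 * gamma2) * t)); last by ring.
by ring.
Qed.

(** The range on which [acos] inverts [cos] and both cosines stay away from 1 and -1. *)
Definition angles_lt_pi (theta : 'rV[R]_4) :=
  0 < theta 0 (inord 1) * tau < pi /\ 0 < theta 0 (inord 3) * t < pi.

Lemma cos_lt1 (x : R) : 0 < x < pi -> -1 < cos x < 1.
Proof.
move=> /andP[x0 xpi]; rewrite -cospi -cos0.
by rewrite !ltr_cos ?in_itv/= ?lexx ?pi_ge0 ?(ltW x0) ?(ltW xpi)// x0 xpi.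
Qed.

Lemma F0_amplitude1 theta : amplitude1 (F0 t tau t theta) =
  (1 - cos (theta 0 (inord 1) * tau) ^+ 2) *
  damped_cos (theta 0 (inord 0)) (theta 0 (inord 2)) (theta 0 (inord 3)) t.
Proof.
rewrite /amplitude1 F0_cos_angle -(echoK (expR (- theta 0 (inord 0) * t))).
by congr echo_amplitude; rewrite /y_ F0E// mxE inordK.
Qed.

Lemma F0_amplitude2 theta : amplitude2 (F0 t tau t theta) =
  (1 - cos (theta 0 (inord 1) * tau) ^+ 2) *
  damped_cos (theta 0 (inord 0)) (theta 0 (inord 2)) (theta 0 (inord 3)) (2 * t).
Proof.
rewrite /amplitude2 F0_cos_angle -(echoK (expR (- theta 0 (inord 0) * (2 * t)))).
congr echo_amplitude.
  rewrite /y_ F0E// mxE inordK//= -expRM_natl; congr expR; ring.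
by rewrite /y_ F0E// mxE inordK.
Qed.

Lemma F0_envelope2 theta : envelope2 (F0 t tau t theta) =
  ((1 - cos (theta 0 (inord 1) * tau) ^+ 2) *
   expR (- (theta 0 (inord 0) / 2 + 2 * theta 0 (inord 2)) * t)) ^+ 2.
Proof.
rewrite /envelope2 F0_amplitude1 F0_amplitude2 damped_cos2 /sin_angle2 F0_cos_angle.
ring.
Qed.

(** After removal of a common positive factor, the last condition reads
    [cos (omega * t) ^+ 2 < 1]. *)
Lemma F0_domainP theta : angles_lt_pi theta -> F0_domain (F0 t tau t theta).
Proof.
move=> [/cos_lt1/andP[c0 c1] /cos_lt1/andP[w0 w1]]; split.
- by rewrite /y_ F0E// mxE inordK//= expR_gt0.
- by rewrite /y_ F0E// mxE inordK//=; lra.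
- by rewrite /y_ F0E// mxE inordK//=; lra.
- rewrite F0_amplitude1 F0_envelope2 /damped_cos mulrA [ltLHS]exprMn.
  rewrite gtr_pMr; first by nra.
  by rewrite exprn_gt0// mulr_gt0 ?expR_gt0//; nra.
Qed.

Lemma F0K theta : angles_lt_pi theta -> F0_inverse (F0 t tau t theta) = theta.
Proof.
move=> ok; have [ka wa] := ok; have /andP[c0 c1] := cos_lt1 _ ka.
have tneq0 : t != 0 by rewrite gt_eqF.
have tauneq0 : tau != 0 by rewrite gt_eqF.
have s0 : 0 < 1 - cos (theta 0 (inord 1) * tau) ^+ 2 by nra.
have g1 : - ln (y_ 0 (F0 t tau t theta)) / t = theta 0 (inord 0).
  by rewrite /y_ F0E// mxE inordK//= expRK; field.
apply/rowP => j; rewrite mxE g1.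
(* Matches the index with the [inord] coordinates used in [F0] before splitting into the four
   cases. *)
have -> : j = inord j by apply/val_inj; rewrite /= inordK.
rewrite inordK//; case: j => -[|[|[|[|//]]]] ? /=.
- by [].
- rewrite F0_cos_angle cosK; first by field.
  by move: ka; rewrite in_itv /= => /andP[/ltW-> /ltW->].
- rewrite F0_envelope2 /sin_angle2 F0_cos_angle lnXn ?mulr_gt0 ?expR_gt0//.
  by rewrite lnM ?posrE ?expR_gt0// expRK -mulr_natl; field.
- rewrite F0_amplitude1 F0_envelope2 sqrtr_sqr gtr0_norm ?mulr_gt0 ?expR_gt0//.
  rewrite /damped_cos mulrA mulrAC divff ?mul1r; last first.
    by rewrite gt_eqF// mulr_gt0 ?expR_gt0.
  rewrite cosK; first by field.
  by move: wa; rewrite in_itv /= => /andP[/ltW-> /ltW->].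
Qed.

Lemma F0_inverseK y : F0_domain y -> F0 t tau t (F0_inverse y) = y.
Proof.
move=> Wy; have s0 := sin_angle2_gt0 y Wy; have e0 := envelope2_gt0 y Wy.
have [y00 y10 y11 ae] := Wy.
have tneq0 : t != 0 by rewrite gt_eqF.
have tauneq0 : tau != 0 by rewrite gt_eqF.
have sne0 : sin_angle2 y != 0 by rewrite gt_eqF.
rewrite F0E//.
have invE k : (k < 4)%N -> F0_inverse y 0 (inord k) =
  [:: - ln (y_ 0 y) / t; acos (cos_angle y) / tau;
      ((ln (sin_angle2 y) - ln (envelope2 y) / 2) / t -
        (- ln (y_ 0 y) / t) / 2) / 2;
      acos (amplitude1 y / Num.sqrt (envelope2 y)) / t]`_k.
  by move=> k4; rewrite mxE inordK.
have e1 : expR (- F0_inverse y 0 (inord 0) * t) = y_ 0 y.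
  rewrite invE//= (_ : _ * t = ln (y_ 0 y)); last by field.
  by rewrite lnK.
have e2 : expR (- F0_inverse y 0 (inord 0) * (2 * t)) = y_ 0 y ^+ 2.
  by rewrite -e1 -expRM_natl; congr expR; ring.
have ec : cos (F0_inverse y 0 (inord 1) * tau) = cos_angle y.
  rewrite invE//= divfK// acosK// in_itv/= /cos_angle; apply/andP; split; lra.
have eE : expR (- (F0_inverse y 0 (inord 0) / 2 + 2 * F0_inverse y 0 (inord 2)) * t)
    = Num.sqrt (envelope2 y) / sin_angle2 y.
  rewrite !invE//= (_ : _ * t = ln (Num.sqrt (envelope2 y)) - ln (sin_angle2 y)).
    by rewrite -lnV ?posrE// -lnM ?posrE ?invr_gt0 ?sqrtr_gt0// lnK// posrE
         divr_gt0 ?sqrtr_gt0.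
  by rewrite ln_sqrt//; field.
have d1 : damped_cos (F0_inverse y 0 (inord 0)) (F0_inverse y 0 (inord 2))
    (F0_inverse y 0 (inord 3)) t = amplitude1 y / sin_angle2 y.
  rewrite /damped_cos eE invE//= divfK//.
  rewrite acosK; first by field; rewrite sne0 gt_eqF// sqrtr_gt0.
  by rewrite in_itv/=; have /andP[/ltW-> /ltW->] := amplitude_ratio y Wy.
have d2 : damped_cos (F0_inverse y 0 (inord 0)) (F0_inverse y 0 (inord 2))
    (F0_inverse y 0 (inord 3)) (2 * t) = amplitude2 y / sin_angle2 y.
  (* With [S = sin_angle2 y], this is [(2 * amplitude1 y ^+ 2 - envelope2 y) / S ^+ 2], whose
     numerator is [S * amplitude2 y] by definition of [envelope2]. *)
  rewrite damped_cos2 d1 eE !expr_div_n sqr_sqrtr ?(ltW e0)//.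
  by rewrite /envelope2; field.
have c1 : cos_angle y ^+ 2 != 1 by rewrite -subr_eq0 -oppr_eq0 opprB.
rewrite /= e1 e2 ec d1 d2.
apply/rowP => j; rewrite mxE.
have -> : j = inord j by apply/val_inj; rewrite /= inordK.
rewrite inordK//; case: j => -[|[|[|[|//]]]] ? /=.
- by [].
- by rewrite /cos_angle /y_; field.
- exact: echo_amplitudeK.
- exact: echo_amplitudeK.
Qed.

Lemma F0_in01 (theta : 'rV[R]_4) : 0 < theta 0 (inord 0) -> 0 < theta 0 (inord 2) ->
  angles_lt_pi theta -> forall i, 0 < F0 t tau t theta 0 i < 1.
Proof.
move=> g1 g2 [/cos_lt1/andP[c0 c1] _] i.
have decay (s : R) : 0 < s -> 0 < expR (- theta 0 (inord 0) * s) < 1.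
  by move=> s0; rewrite expR_gt0 expR_lt1 mulNr oppr_lt0 mulr_gt0.
(* The square is at most [expR (- (gamma1 + 4 * gamma2) * s)], and [gamma2] is positive. This is the
   bound on [C] asked by [echo_in01]. *)
have damp (s : R) : 0 < s -> damped_cos (theta 0 (inord 0)) (theta 0 (inord 2))
    (theta 0 (inord 3)) s ^+ 2 <= expR (- theta 0 (inord 0) * s).
  move=> s0; rewrite exprMn -[leRHS]mulr1 ler_pM ?sqr_ge0//.
  by rewrite -expRM_natl ler_expR; nra.
rewrite F0E// mxE; case: i => -[|[|[|[|//]]]] ? /=.
- exact: decay.
- by apply/andP; split; lra.
- by apply: echo_in01; rewrite ?decay ?damp// c0.
- by apply: echo_in01; rewrite ?decay ?damp ?mulr_gt0// c0.
Qed.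

End Inverse.

(** * Choice of the durations and assembly of the diffeomorphism *)

Theorem lemma3p3 (R : realType) (lo hi : 'rV[R]_4)
    (lo_lt_hi : forall i, lo 0 i < hi 0 i)
    (box_compact : compact (closure (open_box lo hi)))
    (box_pos : closure (open_box lo hi) `<=`
               [set theta : 'rV[R]_4 | forall i, 0 < theta 0 i]) :
  exists t1 tau2 t3 : R,
    [/\ 0 < t1, 0 < tau2, 0 < t3,
        forall theta, open_box lo hi theta ->
          forall i, 0 < F0 t1 tau2 t3 theta 0 i < 1
      & diffeomorphism (open_box lo hi) (F0 t1 tau2 t3 @` open_box lo hi)
          (F0 t1 tau2 t3)].
Proof.
set U := open_box lo hi.
(* The denominators are positive and exceed the upper bounds of [omega] and [kappa], so both angles
   stay below [pi] on the whole box. *)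
pose t := pi / (1 + `|hi 0 (inord 3)|); pose tau := pi / (1 + `|hi 0 (inord 1)|).
have t0 : 0 < t by rewrite divr_gt0 ?pi_gt0// ltr_wpDr.
have tau0 : 0 < tau by rewrite divr_gt0 ?pi_gt0// ltr_wpDr.
have pos theta : U theta -> forall i, 0 < theta 0 i.
  by move=> Utheta; apply: box_pos; exact: subset_closure.
have lt_pi theta i : U theta -> 0 < theta 0 i * (pi / (1 + `|hi 0 i|)) < pi.
  move=> Utheta; have d0 : 0 < 1 + `|hi 0 i| by rewrite ltr_wpDr.
  rewrite mulr_gt0 ?divr_gt0 ?pi_gt0 ?(pos _ Utheta)//= mulrCA.
  rewrite -[ltRHS]mulr1 ltr_pM2l ?pi_gt0// ltr_pdivrMr// mul1r.
  have /andP[_ /lt_le_trans] := Utheta i; apply.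
  by rewrite (le_trans (ler_norm _))// lerDr.
have ok theta : U theta -> angles_lt_pi t tau theta.
  by move=> Utheta; split; exact: lt_pi.
exists t, tau, t; split; [exact: t0|exact: tau0|exact: t0| |].
  by move=> theta Utheta; apply: F0_in01 => //; [exact: pos|exact: pos|exact: ok].
have oU : open U by exact: open_open_box.
(* [F0K] gives one inclusion and [F0_inverseK] the other. Openness of the image then follows from
   continuity of the inverse. *)
have VE : F0 t tau t @` U = F0_domain `&` F0_inverse t tau @^-1` U.
  apply/seteqP; split=> [_ [theta Utheta <-]|y [Wy Uy]].
    by split; [exact/F0_domainP/ok|rewrite /= F0K//; exact: ok].
  by exists (F0_inverse t tau y) => //; exact: F0_inverseK.
have oV : open (F0 t tau t @` U).
  rewrite VE; apply: open_setI_preimage => //; first exact: open_F0_domain.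
  apply: smooth_on_continuous; apply: smooth_on_row; first exact: open_F0_domain.
  by move=> j; exact: smooth_F0_inverse.
have FK : {in U, cancel (F0 t tau t) (F0_inverse t tau)}.
  by move=> theta; rewrite inE => /ok; exact: F0K.
split; [exact: oU|exact: oV| | |].
- by apply: inj_bij; exact: can_in_inj FK.
- apply: smooth_on_row => // j.
  exact: smooth_F0.
- exists (F0_inverse t tau); split=> //; apply: smooth_on_row => // j.
  by apply: smooth_subset (smooth_F0_inverse _ _ j); rewrite VE => y [].
Qed.
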